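(* Let $r$ be an integer and let $G$ be a $(P_6+rP_3)$-free graph. Let $p,q$ be positive integers, let $X,Y\subseteq V(G)$ be disjoint sets such that $X$ is stable and every connected component of $G|Y$ has at most $p$ vertices, let $\mathcal{Z}$ be a set of subsets of $Y$, each of size $q$, each inducing a connected subgraph of $G$ and each having an attachment in $X$, and let $H$ be the hypergraph with vertex set $X$ and hyperedge set $\{X(Z):Z\in\mathcal{Z}\}$. Let $C=\binom{p}{q}(2r+4)$. Then $$\tau(H)\le 11C^2(C+\nu(H)+3)\binom{C+\nu(H)}{\nu(H)}^2.$$ In particular, there is a function $f_{r,p,q}:\mathbb{N}\to\mathbb{N}$ (depending only on $r,p,q$) such that $\tau(H)\le f_{r,p,q}(\nu(H))$.
   Context: Graphs are finite and simple. $P_t$ is the path on $t$ vertices; $P_6+rP_3$ is the disjoint union of one $P_6$ and $r$ copies of $P_3$; $G$ is $H$-free if it has no induced subgraph isomorphic to $H$. $G|A$ is the induced subgraph on $A$. A set is stable if no edge has both ends in it. For $A\subseteq V(G)$, an attachment of $A$ is a vertex outside $A$ with a neighbor in $A$, and $X(Z)$ denotes the set of attachments of $Z$ lying in $X$. A hypergraph $H$ has finite vertex set $V(H)$ and a set of nonempty subsets of $V(H)$ called hyperedges. A matching is a set of pairwise disjoint hyperedges; $\nu(H)$ is the maximum size of a matching. A hitting set is a set of vertices meeting every hyperedge; $\tau(H)$ is the minimum size of a hitting set. *)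

(* Defs.v *)
From mathcomp Require Import all_boot.

Set Implicit Arguments.
Unset Strict Implicit.
Unset Printing Implicit Defensive.

Record sgraph := SGraph {
  vertex :> finType;
  adj : rel vertex;
  adj_sym : symmetric adj;
  adj_irrefl : irreflexive adj }.

Definition isomorphic (G H : sgraph) : Prop :=
  exists2 f : G -> H, bijective f & {mono f : x y / adj x y}.

Section Induced.
Variables (G : sgraph) (A : {set G}).

Definition induced_adj : rel {x : G | x \in A} :=
  fun u v => adj (val u) (val v).

Lemma induced_adj_sym : symmetric induced_adj.
Proof. by move=> u v; apply: adj_sym. Qed.

Lemma induced_adj_irrefl : irreflexive induced_adj.
Proof. by move=> u; apply: adj_irrefl. Qed.

Definition induced : sgraph := SGraph induced_adj_sym induced_adj_irrefl.
End Induced.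

Definition free_of (H G : sgraph) : Prop :=
  forall A : {set G}, ~ isomorphic (induced A) H.

Section Path.
Variable t : nat.

Definition path_adj : rel 'I_t :=
  fun i j => (i.+1 == j :> nat) || (j.+1 == i :> nat).

Lemma path_adj_sym : symmetric path_adj.
Proof. by move=> i j; rewrite /path_adj orbC. Qed.

Lemma path_adj_irrefl : irreflexive path_adj.
Proof. by move=> i; rewrite /path_adj orbb eqn_leq ltnn. Qed.

Definition path_graph : sgraph := SGraph path_adj_sym path_adj_irrefl.
End Path.

Section DisjointUnion.
Variables G H : sgraph.

Definition union_adj : rel (G + H) :=
  fun u v => match u, v with
             | inl x, inl y => adj x y
             | inr x, inr y => adj x y
             | _, _ => false
             end.

Lemma union_adj_sym : symmetric union_adj.
Proof. by move=> [x|x] [y|y] //=; apply: adj_sym. Qed.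

Lemma union_adj_irrefl : irreflexive union_adj.
Proof. by move=> [x|x]; apply: adj_irrefl. Qed.

Definition disjoint_union : sgraph := SGraph union_adj_sym union_adj_irrefl.
End DisjointUnion.

Section Copies.
Variables (r : nat) (G : sgraph).

Definition copies_adj : rel ('I_r * G) :=
  fun u v => (u.1 == v.1) && adj u.2 v.2.

Lemma copies_adj_sym : symmetric copies_adj.
Proof. by move=> u v; rewrite /copies_adj eq_sym adj_sym. Qed.

Lemma copies_adj_irrefl : irreflexive copies_adj.
Proof. by move=> u; rewrite /copies_adj adj_irrefl andbF. Qed.

Definition copies : sgraph := SGraph copies_adj_sym copies_adj_irrefl.
End Copies.

Definition stable (G : sgraph) (A : {set G}) : Prop :=
  {in A &, forall x y, ~~ adj x y}.

Definition components (G : sgraph) : {set {set G}} :=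
  [set [set y | connect (@adj G) x y] | x : G].

(* The null graph counts as connected here. *)
Definition connected_graph (G : sgraph) : Prop :=
  forall x y : G, connect (@adj G) x y.

Definition attachment (G : sgraph) (A : {set G}) (x : G) : bool :=
  (x \notin A) && [exists y in A, adj x y].

Definition attachments (G : sgraph) (X Z : {set G}) : {set G} :=
  [set x in X | attachment Z x].

Record hypergraph (T : finType) := Hypergraph {
  hvertices : {set T};
  hyperedges : {set {set T}};
  hyperedge_sub : forall e, e \in hyperedges -> e \subset hvertices;
  hyperedge_neq0 : forall e, e \in hyperedges -> e != set0 }.

Section HypergraphParameters.
Variables (T : finType) (H : hypergraph T).

Definition matching (M : {set {set T}}) : bool :=
  (M \subset hyperedges H) && trivIset M.

Definition nu : nat := \max_(M : {set {set T}} | matching M) #|M|.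

Definition hitting_set (S : {set T}) : bool :=
  (S \subset hvertices H) && [forall e in hyperedges H, S :&: e != set0].

Lemma hitting_set_hvertices : hitting_set (hvertices H).
Proof.
rewrite /hitting_set subxx /=; apply/forall_inP => e He.
by rewrite (setIidPr (hyperedge_sub He)) (hyperedge_neq0 He).
Qed.

(* The minimum is over a nonempty family by [hitting_set_hvertices]. *)
Definition tau : nat :=
  #|[arg min_(S < hvertices H | hitting_set S) #|S|]|.
End HypergraphParameters.

Section AttachmentHypergraph.
Variables (G : sgraph) (X : {set G}) (ZZ : {set {set G}}).
Hypothesis ZZ_att : forall Z, Z \in ZZ -> attachments X Z != set0.

Lemma attachments_edge_sub e :
  e \in [set attachments X Z | Z in ZZ] -> e \subset X.
Proof. by case/imsetP=> Z _ ->; apply/subsetP => x; rewrite inE => /andP[]. Qed.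

Lemma attachments_edge_neq0 e :
  e \in [set attachments X Z | Z in ZZ] -> e != set0.
Proof. by case/imsetP=> Z HZ ->; apply: ZZ_att. Qed.

Definition attachment_hypergraph : hypergraph G :=
  Hypergraph attachments_edge_sub attachments_edge_neq0.
End AttachmentHypergraph.

(* Main.v *)
(** The bound is that of Ding, Seymour and Winkler for hypergraphs having no
    [k] hyperedges such that any two of them share a vertex lying in none of
    the others.  If there is no small hitting set, then the epsilon-net theorem
    (such a hypergraph has VC dimension below [k (k - 1) / 2]) shows that every
    weighting of the vertices has a light hyperedge, so by multiplicative weights
    there is a multiset of hyperedges in which every vertex has small degree.
    A random sample of it, cleaned up by deleting a few hyperedges, contains
    by Ramsey's theorem either many disjoint hyperedges or [k] hyperedges of the
    excluded kind.

    In the attachment hypergraph, [k] such hyperedges come from [k] sets [Z], of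
    which [2 r + 4] lie in distinct components of [G|Y].  Three of them, chained
    through the shared attachments, contain an induced [P_6], a fourth one lends
    its attachment, and the remaining [r] pairs each yield an induced [P_3]. *)

Require Import Defs.
From mathcomp Require Import all_boot.
From mathcomp Require Import zify.

Set Implicit Arguments.
Unset Strict Implicit.
Unset Printing Implicit Defensive.

(** * Resampling and shattering *)

Lemma sum_nat_of_bool (T : finType) (P : pred T) :
  \sum_x (P x : nat) = #|[set x | P x]|.
Proof. by rewrite -sum1dep_card [RHS]big_mkcond; apply: eq_bigr => x _; case: (P x). Qed.

Section Resampling.
Variables (I Omega : finType).
Implicit Types (f : {ffun I -> Omega}).

Definition resample f h c : {ffun I -> Omega} :=
  [ffun i => if i == h then c else f i].

(** Exchanging [c] with [f h] is an involution on pairs, so a uniform sample with one coordinate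
    redrawn stays uniform. This plays the role of independence: the other coordinates are fixed
    while coordinate [h] is averaged. *)
Lemma sum_resample (F : {ffun I -> Omega} -> nat) (h : I) :
  \sum_f \sum_c F (resample f h c) = #|Omega| * \sum_f F f.
Proof.
pose swap (u : {ffun I -> Omega} * Omega) := (resample u.1 h u.2, u.1 h).
have swapK : involutive swap.
  case=> f c; congr pair; last by rewrite /= ffunE eqxx.
  by apply/ffunP=> i; rewrite !ffunE; case: eqP => // ->.
rewrite pair_big /= (reindex_inj (inv_inj swapK)) /=.
rewrite (eq_bigr (fun u : {ffun I -> Omega} * Omega => F u.1)); last first.
  by move=> u _; rewrite -[resample _ _ _]/((swap (swap u)).1) swapK.
rewrite -(pair_big xpredT xpredT (fun f (_ : Omega) => F f)) /= big_distrr.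
by apply: eq_bigr => f _; rewrite sum_nat_const.
Qed.

End Resampling.

Section Shattering.
Variable T : finType.
Implicit Types (F : {set {set T}}) (S A B : {set T}).

Definition shatters F S : bool :=
  [forall A in powerset S, exists B in F, B :&: S == A].

Lemma shattersP F S :
  reflect (forall A, A \subset S -> exists2 B, B \in F & B :&: S = A)
          (shatters F S).
Proof.
apply: (iffP forall_inP) => [h A sAS | h A].
  have /exists_inP[B BF /eqP e] : [exists B in F, B :&: S == A].
    by apply: h; rewrite inE.
  by exists B.
rewrite inE => /h[B BF e]; apply/exists_inP; exists B => //; exact/eqP.
Qed.

Definition shattered F : {set {set T}} := [set S | shatters F S].

Lemma shattersS F F' S : F \subset F' -> shatters F S -> shatters F' S.
Proof.
move=> sF /shattersP h; apply/shattersP => A /h[B BF <-].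
by exists B => //; apply: (subsetP sF).
Qed.

(* Pajor's form of the Sauer-Shelah lemma. *)
Lemma card_shattered F : #|F| <= #|shattered F|.
Proof.
have [n] := ubnP #|F|; elim: n F => // n IH F ltFn.
have [le1|gt1] := leqP #|F| 1.
  have [->|[B BF]] := set_0Vmem F; first by rewrite cards0.
  apply: leq_trans le1 _; apply/card_gt0P; exists set0; rewrite inE.
  apply/shattersP => A; rewrite subset0 => /eqP->; exists B => //.
  by rewrite setI0.
have /card_gt1P[B1 [B2 [B1F B2F neB]]] := gt1.
have [x xB] : exists x, (x \in B1) != (x \in B2).
  apply/existsP; rewrite -[X in is_true X]negbK negb_exists.
  apply: contra neB => /forallP h; apply/eqP/setP=> x.
  by apply/eqP; move: (h x); rewrite negbK.
pose F1 := [set B in F | x \in B]; pose F0 := [set B in F | x \notin B].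
have FE : #|F| = #|F1| + #|F0|.
  rewrite -(cardsID [set B : {set T} | x \in B] F); congr (_ + _).
    by apply: eq_card => B; rewrite !inE.
  by apply: eq_card => B; rewrite !inE andbC.
have [F1gt0 F0gt0] : 0 < #|F1| /\ 0 < #|F0|.
  split; apply/card_gt0P; move: xB;
    case x1: (x \in B1); case x2: (x \in B2) => // _;
    by [exists B1; rewrite inE B1F x1 | exists B2; rewrite inE B2F x2].
have IH1 : #|F1| <= #|shattered F1| by apply: IH; lia.
have IH0 : #|F0| <= #|shattered F0| by apply: IH; lia.
have sF1 : F1 \subset F by apply/subsetP => B; rewrite inE => /andP[].
have sF0 : F0 \subset F by apply/subsetP => B; rewrite inE => /andP[].
have x1 S : S \in shattered F1 -> x \notin S.
  rewrite inE => /shattersP h; apply/negP => xS.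
  have [B + /setP/(_ x)] := h set0 (sub0set _).
  by rewrite !inE xS => /andP[_ ->].
have x0 S : S \in shattered F0 -> x \notin S.
  rewrite inE => /shattersP h; apply/negP => xS.
  have [B + /setP/(_ x)] := h S (subxx _).
  by rewrite !inE xS => /andP[_ /negPf->].
(* A set shattered by both halves counts twice for [F]: as it stands, and with [x] added, since the
   choice of the half decides whether [x] is in. *)
pose U := shattered F1 :|: shattered F0.
pose V := [set x |: S | S in shattered F1 :&: shattered F0].
have cV : #|V| = #|shattered F1 :&: shattered F0|.
  apply: card_in_imset => S S' /setIP[/x1 xS _] /setIP[/x1 xS' _] e.
  by rewrite -(setU1K xS) -(setU1K xS') e.
have dUV : [disjoint U & V].
  rewrite disjoint_sym; apply/pred0P => S /=; apply/negP => /andP[].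
  case/imsetP=> S' _ -> /setUP[/x1|/x0]; by rewrite setU11.
have sUV : U :|: V \subset shattered F.
  apply/subsetP => S /setUP[/setUP[]|].
  - by rewrite !inE; apply: shattersS.
  - by rewrite !inE; apply: shattersS.
  case/imsetP=> S0 /setIP[S1 S0'] ->; rewrite inE; apply/shattersP => A sA.
  have sAx : A :\ x \subset S0.
    by apply/subsetP => y; rewrite !inE => /andP[ne /(subsetP sA)];
      rewrite !inE (negPf ne).
  have [xA|xA] := boolP (x \in A).
    move: S1; rewrite inE => /shattersP/(_ _ sAx)[B].
    rewrite inE => /andP[BF xB'] e; exists B => //.
    by rewrite setIUr e (setIidPr _) ?sub1set // setD1K.
  move: S0'; rewrite inE => /shattersP/(_ _ sAx)[B].
  rewrite inE => /andP[BF xB'] e; exists B => //.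
  rewrite setIUr e; apply/setP=> y; rewrite !inE.
  by case: (y =P x) => [->|_]; rewrite ?(negPf xA) ?(negPf xB') ?andbF ?andbT.
apply: leq_trans (subset_leq_card sUV).
rewrite cardsU (disjoint_setI0 dUV) cards0 subn0 cV /U.
have := cardsUI (shattered F1) (shattered F0); lia.
Qed.

(** A set of at most [d] elements is coded by its enumeration, padded with [None] to length [d]. *)
Lemma card_small_sets d : #|[set S : {set T} | #|S| <= d]| <= #|T|.+1 ^ d.
Proof.
pose g (f : {ffun 'I_d -> option T}) := [set x | Some x \in codom f].
rewrite -card_option -[d in _ ^ d]card_ord -card_ffun -cardsT.
apply: leq_trans (leq_imset_card g _); apply: subset_leq_card.
apply/subsetP => S; rewrite inE => cS; apply/imsetP.
exists [ffun i : 'I_d => nth None (map Some (enum S)) i] => //.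
apply/setP=> x; rewrite inE; apply/idP/codomP => [xS|[i]].
  have xe : x \in enum S by rewrite mem_enum.
  have lt : index x (enum S) < d.
    by apply: leq_trans cS; rewrite cardE index_mem.
  exists (Ordinal lt); rewrite ffunE /= (nth_map x) ?index_mem //.
  by rewrite nth_index.
rewrite ffunE => e; rewrite -mem_enum -(mem_map (f := Some)); last by move=> ? ? [].
rewrite e; apply: mem_nth; rewrite ltnNge; apply/negP => le.
by move: e; rewrite nth_default.
Qed.

Lemma sauer_shelah F d :
  (forall S, shatters F S -> #|S| <= d) -> #|F| <= #|T|.+1 ^ d.
Proof.
move=> h; apply: leq_trans (card_shattered F) _.
apply: leq_trans (card_small_sets d); apply: subset_leq_card.
by apply/subsetP => S; rewrite !inE => /h.
Qed.

End Shattering.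

(** A preimage cannot separate points with equal image, so [g] is injective on a shattered set.
    Hence passing to the indices of a sample, or to copies of vertices, does not raise the VC
    dimension. *)
Lemma shatters_preimset (T U : finType) (g : T -> U) (E : {set {set U}}) (S : {set T}) :
  shatters [set g @^-1: B | B : {set U} in E] S ->
  {in S &, injective g} /\ shatters E (g @: S).
Proof.
move=> /shattersP h.
have ginj : {in S &, injective g}.
  move=> x y xS yS e.
  have [_ /imsetP[B BE ->] /setP eq] := h [set x] ltac:(by rewrite sub1set).
  move: (eq x) (eq y); rewrite !inE eqxx xS yS e => -> /esym/eqP.
  by move=> ->.
split=> //; apply/shattersP => A sA.
have [|_ /imsetP[B BE ->] /setP eq] := h (S :&: g @^-1: A).
  exact: subsetIl.
exists B => //; apply/setP=> u; rewrite inE.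
have [/imsetP[x xS ->]|nu] := boolP (u \in g @: S).
  by move: (eq x); rewrite !inE xS andbT.
by rewrite andbF; apply/esym/negP => /(subsetP sA); apply/negP.
Qed.

(** * Epsilon-nets *)

Lemma dense_gt0 (Omega : finType) k (e : {set Omega}) :
  #|Omega| < k * #|e| -> 0 < #|Omega|.
Proof.
case: (posnP #|e|) => [->|e0 _]; first by rewrite muln0.
exact: leq_trans e0 (max_card _).
Qed.

Section DoubleSampling.
Variable s : nat.
Local Notation J := (bool * 'I_s)%type.
Implicit Types (t : {set J}) (sigma : {ffun 'I_s -> bool}).

Definition swap_sample sigma (u : J) : J := (u.1 (+) sigma u.2, u.2).

Lemma swap_sampleK sigma : involutive (swap_sample sigma).
Proof. by case=> b i; rewrite /swap_sample /= -addbA addbb addbF. Qed.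

(* A trace missed by the first half of the sample and hit [m] times by the second. *)
Definition one_sided m t : bool :=
  [forall i, (false, i) \notin t] && (m <= #|[set i | (true, i) \in t]|).

(* An index hit on the second side pins the swap at that index. *)
Lemma card_one_sided m t :
  #|[set sigma | one_sided m (swap_sample sigma @^-1: t)]| * 2 ^ m <= 2 ^ s.
Proof.
set A := [set _ | _]; have [->|[sg0]] := set_0Vmem A; first by rewrite cards0.
rewrite inE => /andP[/forallP t0 lem].
set I := [set _ | _] in lem.
have sub sg : sg \in A -> [set i | sg i != sg0 i] \subset ~: I.
  rewrite inE => /andP[/forallP tf _]; apply/subsetP => i; rewrite !inE => ne.
  apply/negP => h; move: (tf i); rewrite !inE; move: h ne.
  by rewrite /swap_sample /=; case: (sg i); case: (sg0 i) => //= ->.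
have inj : {in A &, injective (fun sg : {ffun (ordinal s) -> bool} => [set i | sg i != sg0 i])}.
  move=> sg sg' _ _ /setP e; apply/ffunP=> i; move: (e i); rewrite !inE.
  by case: (sg i); case: (sg' i); case: (sg0 i).
have : #|A| <= 2 ^ #|~: I|.
  rewrite -card_powerset -(card_in_imset inj); apply: subset_leq_card.
  by apply/subsetP => _ /imsetP[sg sgA ->]; rewrite inE sub.
move=> h; apply: (@leq_trans (2 ^ #|~: I| * 2 ^ #|I|)).
  by apply: leq_mul => //; rewrite leq_exp2l.
by rewrite -expnD addnC cardsC card_ord.
Qed.

Variables (Omega : finType) (E : {set {set Omega}}).
Implicit Types (z : {ffun J -> Omega}).

Definition one_sided_sample m z : bool :=
  [exists e in E, one_sided m (z @^-1: (e : {set Omega}))].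

(** Symmetrization: permuting samples by a swap leaves the count unchanged. For a fixed [z] only the
    traces of [E] on the index set matter; Sauer-Shelah bounds their number, and each is one-sided
    for at most a fraction [1 / 2 ^ m] of the swaps. *)
Lemma card_one_sided_sample m d :
    (forall S, shatters E S -> #|S| <= d) ->
  #|[set z | one_sided_sample m z]| * 2 ^ m <=
    (2 * s).+1 ^ d * #|{: {ffun J -> Omega}}|.
Proof.
move=> vc.
pose act sigma z := [ffun u => z (swap_sample sigma u)] : {ffun J -> Omega}.
have actK sigma : involutive (act sigma).
  by move=> z; apply/ffunP=> u; rewrite !ffunE swap_sampleK.
have swp : \sum_sigma \sum_z one_sided_sample m (act sigma z)
           = 2 ^ s * #|[set z | one_sided_sample m z]|.
  rewrite (eq_bigr (fun=> #|[set z | one_sided_sample m z]|)).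
    by rewrite sum_nat_const card_ffun card_bool card_ord.
  by move=> sg _; rewrite -sum_nat_of_bool [RHS](reindex_inj (inv_inj (actK sg))).
have cnt z : (\sum_sigma one_sided_sample m (act sigma z)) * 2 ^ m
             <= (2 * s).+1 ^ d * 2 ^ s.
  pose Tr := [set z @^-1: e | e : {set Omega} in E].
  have cTr : #|Tr| <= (2 * s).+1 ^ d.
    have -> : 2 * s = #|{: J}| by rewrite card_prod card_bool card_ord.
    apply: sauer_shelah => S /shatters_preimset[inj /vc].
    by rewrite card_in_imset.
  apply: (@leq_trans (\sum_(t in Tr) 2 ^ s)); last first.
    by rewrite sum_nat_const leq_mul2r cTr orbT.
  apply: (@leq_trans (\sum_(t in Tr)
      #|[set sigma | one_sided m (swap_sample sigma @^-1: t)]| * 2 ^ m));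
    last by apply: leq_sum => t _; apply: card_one_sided.
  rewrite -big_distrl leq_mul2r; apply/orP; right.
  rewrite (eq_bigr (fun t => \sum_sigma
     (one_sided m (swap_sample sigma @^-1: t) : nat))); last first.
    by move=> t _; rewrite sum_nat_of_bool.
  rewrite exchange_big; apply: leq_sum => sg _.
  case bz: (one_sided_sample _ _) => //; have /exists_inP[e eE h] := bz.
  have tT : z @^-1: e \in Tr by apply/imsetP; exists e.
  rewrite (bigD1 _ tT) /= (_ : one_sided _ _ = true) //.
  rewrite -[RHS]h; congr (one_sided m _).
  by apply/setP=> u; rewrite !inE ffunE.
have := @leq_sum _ (index_enum {ffun J -> Omega}) xpredT _ _ (fun z _ => cnt z).
rewrite -big_distrl /= exchange_big swp sum_nat_const.
have : 0 < 2 ^ s by rewrite expn_gt0.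
move: (2 ^ s) (2 ^ m) => a b a0.
set c := #|_|; set c' := #|_| => h; rewrite -(leq_pmul2l a0); lia.
Qed.

(* Reverse Markov: on average a set [e] of density above [1 / k] is hit [m]
   times by the second half of a sample of size [2 * k * m], hence at least [m]
   times with probability at least [1 / s]. *)
Lemma card_one_sided_sample_ge k m :
    0 < m -> s = k * m ->
    (forall e, e \in E -> #|Omega| < k * #|e|) ->
    (forall S : {set Omega}, #|S| <= s -> exists2 e, e \in E & S :&: e = set0) ->
  #|{: {ffun J -> Omega}}| <= s * #|[set z | one_sided_sample m z]|.
Proof.
move=> m0 sE dense nonet.
have O0 : 0 < #|Omega|.
  have [|e eE _] := nonet set0; first by rewrite cards0.
  exact: dense_gt0 (dense e eE).
pose base z := [set z (false, i) | i : 'I_s].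
have cbase z : #|base z| <= s.
  by rewrite -[X in _ <= X]card_ord; apply: leq_imset_card.
pose ms z := odflt set0 [pick e in E | base z :&: e == set0].
have msP z : ms z \in E /\ base z :&: ms z = set0.
  rewrite /ms; case: pickP => [e /andP[eE /eqP] //|].
  by have [e eE e0] := nonet _ (cbase z) => /(_ e); rewrite eE e0 eqxx.
pose hits z := #|[set i | z (true, i) \in ms z]|.
have hits_le z : hits z <= m.-1 + s * one_sided_sample m z.
  have [lt|le] := ltnP (hits z) m; first by apply: leq_trans (leq_addr _ _); lia.
  rewrite (_ : one_sided_sample m z = true).
    rewrite muln1; apply: leq_trans (leq_addl _ _).
    by rewrite -[X in _ <= X]card_ord; apply: max_card.
  have [mE /setP m_0] := msP z; apply/exists_inP; exists (ms z) => //.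
  apply/andP; split; last first.
    by rewrite (eq_card (B := [set i | z (true, i) \in ms z])) // => i; rewrite !inE.
  apply/forallP=> i; rewrite inE; apply/negP => h.
  have := m_0 (z (false, i)); rewrite !inE h andbT => /imsetP[]; by exists i.
have hits_sum : #|{: {ffun J -> Omega}}| * m <= \sum_z hits z.
  rewrite (eq_bigr (fun z => \sum_i (z (true, i) \in ms z))); last first.
    by move=> z _; rewrite sum_nat_of_bool.
  (* The constant sample serves only to supply a member of [E], whose density forces [k] to be
     positive. *)
  have k0 : 0 < k by have := dense _ (msP [ffun=> enum_val (Ordinal O0)]).1; case: (k).
  rewrite exchange_big -(leq_pmul2l k0) big_distrr /=.
  apply: (@leq_trans (\sum_(i < s) #|{: {ffun J -> Omega}}|)).
    by rewrite sum_nat_const card_ord; move: sE; set c := #|_|; nia.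
  apply: leq_sum => i _; rewrite -(leq_pmul2l O0) mulnCA.
  rewrite -(sum_resample (fun z => nat_of_bool (z (true, i) \in ms z)) (true, i)).
  rewrite mulnC -sum_nat_const big_distrr; apply: leq_sum => z _.
  rewrite (eq_bigr (fun c => nat_of_bool (c \in ms z))); last first.
    (* The chosen set depends only on the first half of the sample, so redrawing a coordinate of the
       second half hits it with its density. *)
    move=> c _; rewrite ffunE eqxx; suff -> : ms (resample z (true, i) c) = ms z by [].
    rewrite /ms; suff -> : base (resample z (true, i) c) = base z by [].
    by apply: eq_imset => j; rewrite ffunE.
  rewrite -big_mkcond /= sum1_card; apply: ltnW.
  by apply: dense; have [] := msP z.
have := @leq_sum _ (index_enum {ffun J -> Omega}) xpredT _ _ (fun z _ => hits_le z).
rewrite big_split /= sum_nat_const -big_distrr /=.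
rewrite sum_nat_of_bool.
move: hits_sum; set c := #|_|; set h := \sum_z _; set b := #|_|; nia.
Qed.

End DoubleSampling.

(** Without a net of size [s = k * m], at least a fraction [1 / s] of the double samples is
    one-sided, while symmetrization allows at most [(2 * s).+1 ^ d / 2 ^ m]. The last hypothesis
    makes these incompatible. *)
Lemma epsilon_net (Omega : finType) (E : {set {set Omega}}) k m d :
    0 < m -> (forall e, e \in E -> #|Omega| < k * #|e|) ->
    (forall S, shatters E S -> #|S| <= d) ->
    (2 * (k * m)).+1 ^ d.+1 <= 2 ^ m ->
  exists2 S : {set Omega}, #|S| <= k * m & forall e, e \in E -> S :&: e != set0.
Proof.
move=> m0 dense vc le.
have [/existsP[S /andP[cS /forall_inP h]]|] :=
  boolP [exists S : {set Omega}, (#|S| <= k * m) && [forall e in E, S :&: e != set0]].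
  by exists S.
rewrite negb_exists => /forallP no; exfalso.
have nonet (S : {set Omega}) : #|S| <= k * m -> exists2 e, e \in E & S :&: e = set0.
  move=> cS; move: (no S); rewrite cS /= negb_forall_in => /exists_inP[e eE].
  by rewrite negbK => /eqP; exists e.
have lo := card_one_sided_sample_ge m0 erefl dense nonet.
have hi := card_one_sided_sample (k * m) m vc.
have O0 : 0 < #|{: {ffun bool * 'I_(k * m) -> Omega}}|.
  rewrite card_ffun expn_gt0; apply/orP; left.
  have [|e eE _] := nonet set0; first by rewrite cards0.
  exact: dense_gt0 (dense e eE).
have q0 : 0 < (2 * (k * m)).+1 ^ d by rewrite expn_gt0.
move: lo hi O0 le q0; rewrite expnS; set n := #|{: _}|; set b := #|_|.
move: (k * m) (2 ^ m) ((2 * _).+1 ^ d) => s p q lo hi n0 le q0.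
have : p * n <= s * q * n.
  rewrite mulnC; apply: leq_trans (leq_mul lo (leqnn p)) _.
  by rewrite -!mulnA leq_mul2l hi orbT.
by rewrite leq_pmul2r //; nia.
Qed.

(** * Multiplicative weights *)

(** Bernoulli's inequality for [(1 - 1 / (y + 1)) ^ n], cleared of denominators; truncated
    subtraction makes the case [n > y] trivial. *)
Lemma bernoulli_pred y n : y.+1 ^ n * (y.+1 - n) <= y ^ n * y.+1.
Proof.
elim: n => [|n IH]; first by rewrite !expn0 subn0.
have [le|lt] := leqP y.+1 n.
  by rewrite (_ : y.+1 - n.+1 = 0) ?muln0 //; lia.
rewrite !expnS; move: (_ ^ n) (y ^ n) IH => a b IH; nia.
Qed.

Lemma expn_succ_lower q u : q ^ u * (q + u) <= q * q.+1 ^ u.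
Proof.
elim: u => [|u IH]; first by rewrite !expn0; lia.
rewrite !expnS; move: (q ^ u) (q.+1 ^ u) IH => a b IH.
have [->|q0] := posnP q; first by lia.
suff : q * a * (q + u.+1) <= q.+1 * (a * (q + u)) by nia.
nia.
Qed.

Lemma expn_dominates p q n : q < p -> exists2 u, 0 < u & n * q ^ u < p ^ u.
Proof.
move=> lt; have [->|q0] := posnP q.
  exists 1 => //; rewrite !expn1; lia.
(* With this exponent Bernoulli's inequality gives [(1 + 1 / q) ^ u >= n + 2]. *)
exists (q * n.+1); first by nia.
apply: (@leq_trans (q.+1 ^ (q * n.+1))); last by rewrite leq_exp2r //; nia.
have := expn_succ_lower q (q * n.+1).
have : 0 < q ^ (q * n.+1) by rewrite expn_gt0 q0.
move: (q ^ _) (q.+1 ^ _) => a b a0 h; rewrite -(ltn_pmul2l q0); nia.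
Qed.

Section Weights.
Variable (T : finType) (E : {set {set T}}).

Lemma weight_update a (w : T -> nat) (e : {set T}) :
  \sum_v w v * a.+1 ^ (v \in e) * a ^ (v \notin e) =
  a * \sum_v w v + \sum_(v in e) w v.
Proof.
rewrite big_distrr [X in _ + X]big_mkcond -big_split /=; apply: eq_bigr => v _.
by case: (v \in e) => /=; rewrite ?expn0 ?expn1; lia.
Qed.

(* One direction of the duality between fractional covers and fractional
   matchings, by multiplicative weights: a vertex in [j] of the edges chosen so
   far weighs [(a + 1)^j * a^(t - j)]; repeatedly choosing a light edge keeps the
   total weight small, so no vertex is in many chosen edges. *)
Lemma low_degree_multiset K :
    0 < K ->
    (forall w : T -> nat, exists2 e, e \in E &
       K.+1 * \sum_(v in e) w v <= \sum_v w v) ->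
  exists n, exists2 F : 'I_n -> {set T}, 0 < n &
    (forall i, F i \in E) /\ (forall v, K * #|[set i | v \in F i]| <= n).
Proof.
(* In each round a vertex gains a factor [a.+1] inside the chosen edge and [a] outside, an integral
   form of the factor [1 + 1 / (2 * K)]. *)
move=> K0 light; pose a := 2 * K.
pose W (l : seq {set T}) v :=
  a.+1 ^ count (fun e : {set T} => v \in e) l *
  a ^ count (fun e : {set T} => v \notin e) l.
have greedy t : exists2 l : seq {set T}, size l = t /\ all (mem E) l &
    K.+1 ^ t * (\sum_v W l v) <= (a * K.+1 + 1) ^ t * #|T|.
  elim: t => [|t [l [sl lE] IH]].
    exists [::] => //; rewrite !expn0 !mul1n (eq_bigr (fun=> 1)) ?sum1_card //.
  have [e eE he] := light (W l).
  exists (e :: l); first by rewrite /= sl eE lE.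
  have -> : \sum_v W (e :: l) v = a * \sum_v W l v + \sum_(v in e) W l v.
    rewrite -weight_update; apply: eq_bigr => v _.
    rewrite /W /= !expnD; set x := a.+1 ^ count _ _; set y := a ^ count _ _.
    by rewrite mulnACA mulnC mulnA.
  rewrite !expnS; move: (\sum_v _) (\sum_(_ in _) _) IH he => x y IH he.
  move: (K.+1 ^ t) (_ ^ t) IH => p q IH.
  suff : p * (K.+1 * (a * x + y)) <= p * ((a * K.+1 + 1) * x) by nia.
  by rewrite leq_mul2l; apply/orP; right; nia.
(* Up to the scaling by [K.+1 ^ K], [P] is the gain over [K] rounds of a vertex in one of the [K]
   chosen edges, and [Q] bounds the growth of the total weight. As [Q < P], for large [u] no vertex
   lies in more than [u] of [K * u] chosen edges. *)
pose P := K.+1 ^ K * (a.+1 * a ^ K.-1).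
pose Q := (a * K.+1 + 1) ^ K.
have ltQP : Q < P.
  have a0 : 0 < a by rewrite /a; lia.
  suff : a * Q < a * P by rewrite ltn_pmul2l.
  have -> : a * P = a.+1 * (a * K.+1) ^ K.
    have aK : a * a ^ K.-1 = a ^ K by rewrite -expnS prednK.
    by rewrite /P expnMn -aK; lia.
  have := bernoulli_pred (a * K.+1) K; rewrite /Q addn1.
  have : 0 < (a * K.+1) ^ K by rewrite expn_gt0; nia.
  move: (_ ^ K) ((_).+1 ^ K) => x y; rewrite /a; nia.
have [u u0 hu] := expn_dominates #|T| ltQP.
have [l [sl lE] hl] := greedy (K * u).
exists (size l), (tnth (in_tuple l)); first by rewrite sl muln_gt0 K0.
split=> [i|v]; first by apply: (allP lE); apply: mem_tnth.
have -> : #|[set i | v \in tnth (in_tuple l) i]| = count (fun e : {set T} => v \in e) l.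
  rewrite -sum1dep_card -(big_tnth 0 addn l (fun e : {set T} => v \in e) (fun=> 1)).
  by rewrite sum1_count.
set j := count _ l; rewrite sl leq_mul2l; apply/orP; right.
rewrite leqNgt; apply/negP => lt.
have hj : j + count (fun e : {set T} => v \notin e) l = K * u.
  by rewrite -sl -(count_predC (fun e : {set T} => v \in e) l).
have Wv : W l v <= \sum_v W l v by rewrite (bigD1 v) //= leq_addr.
have Wlo : a.+1 ^ u * a ^ (K.-1 * u) <= W l v.
  rewrite /W -/j; have -> : j = u + (j - u) by lia.
  rewrite expnD -mulnA leq_mul2l; apply/orP; right.
  have -> : K.-1 * u = (j - u) + count (fun e : {set T} => v \notin e) l by nia.
  by rewrite expnD leq_mul2r leq_exp2r ?orbT // ?leqnSn; lia.
have : P ^ u <= Q ^ u * #|T|.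
  rewrite /P /Q expnMn -!expnM; apply: leq_trans hl; apply: leq_mul => //.
  by rewrite expnMn -expnM (leq_trans Wlo Wv).
by rewrite mulnC leqNgt hu.
Qed.

End Weights.

(** * Ramsey's theorem and random sampling *)

Section Ramsey.
Variables (I : finType) (e : rel I).
Hypothesis e_sym : symmetric e.

(** The Erdos-Szekeres argument: by Pascal's rule a vertex has enough neighbors or enough
    non-neighbors for the induction, and it extends the clique or stable set found there. *)
Lemma ramsey a b (A : {set I}) : 'C(a + b, a) <= #|A| ->
  (exists2 B : {set I}, B \subset A &
     #|B| = a.+1 /\ {in B &, forall i j, i != j -> e i j}) \/
  (exists2 B : {set I}, B \subset A &
     #|B| = b.+1 /\ {in B &, forall i j, i != j -> ~~ e i j}).
Proof.
have single (A' : {set I}) : 0 < #|A'| ->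
    exists2 B : {set I}, B \subset A' & #|B| = 1 /\
      (forall R : I -> I -> Prop, {in B &, forall i j, i != j -> R i j}).
  case/card_gt0P=> x xA; exists [set x]; rewrite ?sub1set ?cards1 //; split=> //.
  by move=> R i j /set1P-> /set1P->; rewrite eqxx.
have [n] := ubnP (a + b); elim: n a b A => // n IH [|a] [|b] A ltn.
- by rewrite bin0 => /single[B sB [cB h]]; left; exists B => //; split=> //; apply: h.
- by rewrite bin0 => /single[B sB [cB h]]; left; exists B => //; split=> //; apply: h.
- by rewrite addn0 binn => /single[B sB [cB h]]; right; exists B => //; split=> //; apply: h.
move=> le; have A0 : 0 < #|A| by apply: leq_trans le; rewrite bin_gt0; lia.
have /card_gt0P[x xA] := A0.
pose A1 := [set y in A :\ x | e x y]; pose A2 := [set y in A :\ x | ~~ e x y].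
have cA : #|A| = (#|A1| + #|A2|).+1.
  rewrite (cardsD1 x A) xA add1n; congr _.+1.
  rewrite -(cardsID [set y | e x y] (A :\ x)); congr (_ + _);
    by apply: eq_card => y; rewrite !inE // andbC.
have sA1 : A1 \subset A :\ x by apply/subsetP=> y; rewrite inE => /andP[].
have sA2 : A2 \subset A :\ x by apply/subsetP=> y; rewrite inE => /andP[].
have sA : A :\ x \subset A by apply: subsetDl.
have [/IH[]|lt1] := leqP 'C(a + b.+1, a) #|A1|; first by lia.
- case=> B sB [cB h]; left; exists (x |: B).
    by rewrite subUset sub1set xA (subset_trans sB) // (subset_trans sA1).
  have xB : x \notin B by apply/negP => /(subsetP sB)/(subsetP sA1); rewrite !inE eqxx.
  split; first by rewrite cardsU1 xB cB.
  have hx y : y \in B -> e x y by move=> /(subsetP sB); rewrite !inE => /andP[].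
  move=> i j /setU1P[->|iB] /setU1P[->|jB]; rewrite ?eqxx // => ne.
  + exact: hx.
  + by rewrite e_sym hx.
  + exact: h.
- case=> B sB hB; right; exists B => //.
  by rewrite (subset_trans sB) // (subset_trans sA1).
have [/IH[]|lt2] := leqP 'C(a.+1 + b, a.+1) #|A2|; first by lia.
- case=> B sB hB; left; exists B => //.
  by rewrite (subset_trans sB) // (subset_trans sA2).
- case=> B sB [cB h]; right; exists (x |: B).
    by rewrite subUset sub1set xA (subset_trans sB) // (subset_trans sA2).
  have xB : x \notin B by apply/negP => /(subsetP sB)/(subsetP sA2); rewrite !inE eqxx.
  split; first by rewrite cardsU1 xB cB.
  have hx y : y \in B -> ~~ e x y by move=> /(subsetP sB); rewrite !inE => /andP[].
  move=> i j /setU1P[->|iB] /setU1P[->|jB]; rewrite ?eqxx // => ne.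
  + exact: hx.
  + by rewrite e_sym hx.
  + exact: h.
have := le; rewrite addSn binS; move: lt1 lt2; rewrite !addSn !addnS; lia.
Qed.

End Ramsey.

(* Random sampling of [2 * N] edges, followed by the deletion of one edge per
   bad incidence. *)
Lemma sparse_sample (T : finType) n (F : 'I_n -> {set T}) N :
    0 < n -> (forall v, 4 * N ^ 2 * #|[set i | v \in F i]| <= n) ->
  exists (g : 'I_(2 * N) -> 'I_n) (I : {set 'I_(2 * N)}), N <= #|I| /\
    forall i j, i \in I -> j \in I -> i != j -> F (g i) :&: F (g j) != set0 ->
      exists2 x, x \in F (g i) :&: F (g j) &
        forall h, h \in I -> h != i -> h != j -> x \notin F (g h).
Proof.
move=> n0 sparse; pose M := 2 * N.
(* Fixing one common point for each pair of indices makes it independent of any third sampled edge,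
   which contains it with probability at most [1 / (4 * N ^ 2)]. *)
pose common (g : {ffun 'I_M -> 'I_n}) (A : {set 'I_M}) :=
  [pick x in \bigcap_(i in A) F (g i)].
pose bad g (u : {set 'I_M} * 'I_M) :=
  if common g u.1 is Some x then x \in F (g u.2) else false.
pose U := [set u : {set 'I_M} * 'I_M | (#|u.1| == 2) && (u.2 \notin u.1)].
have cU : #|U| <= 4 * N ^ 3.
  apply: (@leq_trans #|setX [set A : {set 'I_M} | #|A| == 2] [set: 'I_M]|).
    by apply: subset_leq_card; apply/subsetP=> u; rewrite !inE andbT => /andP[].
  rewrite cardsX card_draws cardsT !card_ord bin2 /M.
  have [->|N0] := posnP N; first by [].
  have -> : (2 * N * (2 * N).-1)./2 = N * (2 * N).-1.
    by rewrite -mulnA -[2 * _]addn0 mul2n addn0 doubleK.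
  nia.
have badP u : u \in U -> 4 * N ^ 2 * \sum_g bad g u <= #|{: {ffun 'I_M -> 'I_n}}|.
  rewrite inE => /andP[_ nu].
  rewrite -(leq_pmul2l n0) mulnCA -[X in X * \sum_g _](card_ord n).
  rewrite -(sum_resample (fun g => nat_of_bool (bad g u)) u.2) big_distrr /=.
  rewrite [n * _]mulnC -sum_nat_const; apply: leq_sum => g _.
  have cE c : common (resample g u.2 c) u.1 = common g u.1.
    rewrite /common; suff -> : \bigcap_(i in u.1) F (resample g u.2 c i) =
      \bigcap_(i in u.1) F (g i) by [].
    by apply: eq_bigr => i iu; rewrite ffunE; case: eqP => // e; rewrite -e iu in nu.
  case cg: (common g u.1) => [x|].
    rewrite (eq_bigr (fun c => nat_of_bool (x \in F c))) ?sum_nat_of_bool ?sparse //.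
    by move=> c _; rewrite /bad cE cg ffunE eqxx.
  rewrite (eq_bigr (fun=> 0)) ?big1 ?muln0 //.
  by move=> c _; rewrite /bad cE cg.
(* [U] has at most [4 * N ^ 3] members, so on average at most [N] of them are bad. *)
have [g hg] : exists g, #|[set u in U | bad g u]| <= N.
  apply/existsP; rewrite -[X in is_true X]negbK negb_exists; apply/negP => /forallP no.
  have : #|{: {ffun 'I_M -> 'I_n}}| * N.+1 <= \sum_g \sum_(u in U) bad g u.
    rewrite -sum_nat_const; apply: leq_sum => g _.
    move: (no g); rewrite -ltnNge => /leq_trans; apply.
    rewrite -sum1dep_card big_mkcondr; apply/eq_leq/eq_bigr => u _.
    by case: (bad g u).
  rewrite exchange_big /= => lo.
  have hi : 4 * N ^ 2 * \sum_(u in U) \sum_g bad g u <=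
      #|U| * #|{: {ffun 'I_M -> 'I_n}}|.
    by rewrite big_distrr -sum_nat_const; apply: leq_sum => u /badP.
  have c0 : 0 < #|{: {ffun 'I_M -> 'I_n}}| by rewrite card_ffun expn_gt0 card_ord n0.
  have [N0|N0] := posnP N.
    move: cU lo; rewrite N0 muln0 leqn0 cards_eq0 => /eqP->.
    rewrite big_set0 /=; lia.
  move: c0 lo hi; set c := #|{: _}|; set x := \sum_(u in U) _ => c0 lo hi.
  have : 4 * N ^ 2 * (c * N.+1) <= 4 * N ^ 3 * c.
    apply: leq_trans (leq_mul (leqnn _) lo) _.
    by apply: leq_trans hi _; apply: leq_mul.
  have : 0 < N ^ 2 by rewrite expn_gt0 N0.
  rewrite [N ^ 3]expnS; move: (N ^ 2) => y; nia.
pose B := snd @: [set u in U | bad g u].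
have cB : #|B| <= N by apply: leq_trans (leq_imset_card _ _) hg.
exists g, (~: B); split.
  by rewrite cardsCs setCK card_ord; apply: leq_trans (leq_sub2l _ cB); rewrite /M; clear; lia.
move=> i j iI jI ne /set0Pn[y yF].
have capE : \bigcap_(l in [set i; j]) F (g l) = F (g i) :&: F (g j).
  by rewrite bigcap_setU !big_set1.
case cg: (common g [set i; j]) => [x|]; last first.
  by move: cg; rewrite /common; case: pickP => // /(_ y); rewrite capE yF.
exists x.
  by move: cg; rewrite /common; case: pickP => // z + [<-]; rewrite capE.
move=> h; rewrite inE => /imsetP nh hi hj; apply/negP => xh; apply: nh.
exists ([set i; j], h) => //; rewrite inE /bad cg xh andbT inE /= cards2 ne.
by rewrite !inE negb_or hi hj.
Qed.

(** * The Ding-Seymour-Winkler bound *)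

Section VertexCover.
Variable T : finType.
Implicit Types (E : {set {set T}}) (S : {set T}).

(* Ding, Seymour and Winkler's [lambda] is the largest such [k]. *)
Definition private_pairs E k : Prop :=
  exists2 F : 'I_k -> {set T}, forall i, F i \in E &
    forall i j, i != j -> exists x, forall l, (x \in F l) = (l == i) || (l == j).

(** Distinct points of [S] are assigned to the pairs of indices, and [F i] is an edge whose trace on
    [S] consists of the points of the pairs containing [i]. *)
Lemma shatters_private_pairs E S k :
  1 < k -> 'C(k, 2) <= #|S| -> shatters E S -> private_pairs E k.
Proof.
move=> k1 le /shattersP sh.
pose P2 := [set A : {set 'I_k} | #|A| == 2].
have cP2 : #|P2| = 'C(k, 2) by rewrite card_draws card_ord.
have /card_gt0P[x0 _] : 0 < #|S| by apply: leq_trans le; rewrite bin_gt0.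
pose h A := nth x0 (enum S) (index A (enum P2)).
have idx A : A \in P2 -> index A (enum P2) < #|S|.
  by move=> AP; apply: leq_trans le; rewrite -cP2 cardE index_mem mem_enum.
have hS A : A \in P2 -> h A \in S.
  by move=> AP; rewrite -mem_enum mem_nth // -cardE idx.
have hinj : {in P2 &, injective h}.
  move=> A B AP BP /eqP; rewrite nth_uniq -?cardE ?idx ?enum_uniq // => /eqP e.
  by rewrite -(nth_index A (s := enum P2) (x := A)) ?mem_enum // e nth_index ?mem_enum.
pose tr i := h @: [set A in P2 | i \in A].
have trS i : tr i \subset S.
  by apply/subsetP=> _ /imsetP[A + ->]; rewrite inE => /andP[/hS].
pose F i := odflt set0 [pick B in E | B :&: S == tr i].
have FP i : F i \in E /\ F i :&: S = tr i.
  rewrite /F; case: pickP => [B /andP[BE /eqP] //|].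
  by have [B BE e] := sh _ (trS i) => /(_ B); rewrite BE e eqxx.
exists F => [i|i j ne]; first by have [] := FP i.
have ijP : [set i; j] \in P2 by rewrite inE cards2 ne.
exists (h [set i; j]) => l.
have [_ /setP/(_ (h [set i; j]))] := FP l; rewrite inE hS // andbT => ->.
apply/imsetP/idP => [[A + e]|lij].
  by rewrite inE => /andP[AP]; rewrite -(hinj _ _ ijP AP e) !inE.
by exists [set i; j] => //; rewrite inE ijP !inE.
Qed.

(** Replacing each vertex [v] by [w v] copies turns weights into cardinalities; a net of copies
    projects to a net of vertices. *)
Lemma weighted_epsilon_net E (w : T -> nat) k m d :
    0 < m -> (forall e, e \in E -> \sum_v w v < k * \sum_(v in e) w v) ->
    (forall S, shatters E S -> #|S| <= d) ->
    (2 * (k * m)).+1 ^ d.+1 <= 2 ^ m ->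
  exists2 S : {set T}, #|S| <= k * m & forall e, e \in E -> S :&: e != set0.
Proof.
move=> m0 dense vc le; pose Omega := {v : T & 'I_(w v)}.
have cpre (e : {set T}) : #|[set u : Omega | tag u \in e]| = \sum_(v in e) w v.
  rewrite -sum1dep_card (eq_bigr (fun v => \sum_(j < w v) 1)); last first.
    by move=> v _; rewrite sum1_card card_ord.
  by rewrite sig_big_dep; apply: eq_bigl => u; rewrite andbT.
have cO : #|{: Omega}| = \sum_v w v.
  by rewrite -cardsT (eq_card (B := [set u | tag u \in [set: T]])) ?cpre;
    [apply: eq_bigl => v|move=> u]; rewrite !inE.
pose pr (u : Omega) := tag u.
have [||S cS hit] := @epsilon_net Omega [set pr @^-1: B | B : {set T} in E] k m d m0 _ _ le.
- by move=> _ /imsetP[e eE ->]; rewrite cO [#|_|]cpre dense.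
- by move=> S /shatters_preimset[inj /vc]; rewrite card_in_imset.
exists (pr @: S); first exact: leq_trans (leq_imset_card _ _) cS.
move=> e eE; have /set0Pn[u] := hit _ (imset_f (fun B : {set T} => pr @^-1: B) eE).
rewrite !inE => /andP[uS ue]; apply/set0Pn; exists (pr u).
by rewrite inE ue imset_f.
Qed.

End VertexCover.

(** * Arithmetic for the size of the net *)

Lemma bin_leq_exp2 n m : 'C(n, m) <= 2 ^ n.
Proof.
have [lt|le] := ltnP n m; first by rewrite bin_small.
rewrite -[2]/(1 + 1) expnDn (bigD1 (Ordinal (le : m < n.+1))) //=.
by rewrite !exp1n !muln1 leq_addr.
Qed.

Lemma cubic_leq_exp2 n : n ^ 2 * (n + 3) <= 16 * 2 ^ n.
Proof.
have [|] := leqP n 3; first by case: n => [|[|[|[|n]]]].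
elim: n => // n IH; rewrite ltnS leq_eqVlt => /orP[/eqP<- //|lt].
have h : n.+1 ^ 2 * (n.+1 + 3) <= 2 * (n ^ 2 * (n + 3)).
  by rewrite -(subnK lt) !expnS !expn0; move: (n - 4) => k; nia.
by apply: leq_trans h _; rewrite [2 ^ n.+1]expnS [16 * _]mulnCA leq_mul2l IH.
Qed.

(** This is the growth condition of [epsilon_net] for the parameters chosen below. The base is at
    most [2 ^ (3 * (lambda + nu + 3))], and [lambda > 2] gives
    [3 * 'C(lambda.+1, 2) <= 2 * lambda ^ 2]. *)
Lemma net_size_bound lambda nu : 2 < lambda ->
  (2 * ((4 * 'C(lambda + nu, nu) ^ 2).+1 * (2 * lambda ^ 2 * (lambda + nu + 3)))).+1
    ^ 'C(lambda.+1, 2) <= 2 ^ (2 * lambda ^ 2 * (lambda + nu + 3)).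
Proof.
move=> l2; set n := lambda + nu; set N := 'C(_, _).
have N0 : 0 < N by rewrite bin_gt0 /n leq_addl.
have hN : N ^ 2 <= 4 ^ n by rewrite -[4]/(2 ^ 2) -expnM mulnC expnM leq_exp2r ?bin_leq_exp2.
have base : (2 * ((4 * N ^ 2).+1 * (2 * lambda ^ 2 * (n + 3)))).+1 <= 2 ^ (3 * (n + 3)).
  have h1 := cubic_leq_exp2 n.
  have h2 : lambda ^ 2 <= n ^ 2 by rewrite leq_exp2r // leq_addr.
  have -> : 2 ^ (3 * (n + 3)) = 512 * 2 ^ n * 4 ^ n.
    rewrite -[512]/(2 ^ 9) -[4]/(2 ^ 2) -expnM -!expnD; congr (2 ^ _); lia.
  have h3 : 2 * (2 * lambda ^ 2 * (n + 3)) <= 64 * 2 ^ n by nia.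
  have : (2 * (2 * lambda ^ 2 * (n + 3))) * (5 * N ^ 2) <= 64 * 2 ^ n * (5 * 4 ^ n).
    by apply: leq_mul => //; rewrite leq_mul2l.
  have : 0 < N ^ 2 by rewrite expn_gt0 N0.
  have : 0 < 2 ^ n * 4 ^ n by rewrite muln_gt0 !expn_gt0.
  move: (2 * lambda ^ 2 * (n + 3)) (2 ^ n) (4 ^ n) (N ^ 2) => a b c y; nia.
apply: (@leq_trans ((2 ^ (3 * (n + 3))) ^ 'C(lambda.+1, 2))).
  by rewrite leq_exp2r ?bin_gt0 //; lia.
rewrite -expnM leq_exp2l //.
have : 2 * 'C(lambda.+1, 2) = lambda.+1 * lambda.
  by rewrite bin2 /= mul2n -[RHS]odd_double_half oddM /= andNb.
nia.
Qed.

Section DingSeymourWinkler.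
Variables (T : finType) (E : {set {set T}}) (lambda nu : nat).
Hypothesis lambda_gt2 : 2 < lambda.
Hypothesis E_neq0 : forall e, e \in E -> e != set0.
Hypothesis no_private_pairs : ~ private_pairs E lambda.+1.
Hypothesis matching_le :
  forall M : {set {set T}}, M \subset E -> trivIset M -> #|M| <= nu.
Local Notation N := 'C(lambda + nu, nu).

(** Ramsey's theorem is applied to the intersection relation on a sparse sample: [lambda.+1]
    pairwise meeting edges form private pairs, and [nu.+1] pairwise disjoint ones form too large a
    matching. *)
Lemma no_low_degree_multiset n (F : 'I_n -> {set T}) :
    0 < n -> (forall i, F i \in E) ->
  ~ (forall v, 4 * N ^ 2 * #|[set i | v \in F i]| <= n).
Proof.
move=> n0 FE /(sparse_sample n0)[g [I [cI sep]]].
pose meet i j := F (g i) :&: F (g j) != set0.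
have meet_sym : symmetric meet by move=> i j; rewrite /meet setIC.
have [] := ramsey meet_sym (a := lambda) (b := nu) (A := I).
- by rewrite -bin_sub ?leq_addr // addKn.
- case=> B sB [cB hB]; apply: no_private_pairs.
  pose b i : 'I_(2 * N) := enum_val (cast_ord (esym cB) i).
  have bB i : b i \in B by apply: enum_valP.
  have bI i : b i \in I by apply: (subsetP sB).
  have binj i j : (b i == b j) = (i == j).
    by rewrite (inj_eq enum_val_inj) (inj_eq (@cast_ord_inj _ _ _)).
  exists (fun i => F (g (b i))) => // i j ne.
  have neb : b i != b j by rewrite binj.
  have [x] := sep _ _ (bI i) (bI j) neb (hB _ _ (bB i) (bB j) neb).
  case/setIP=> xi xj hx; exists x => l.
  have [->|nli] := eqVneq l i; first by rewrite xi.
  have [->|nlj] := eqVneq l j; first by rewrite xj.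
  by rewrite (negPf (hx _ (bI l) _ _)) // binj.
case=> B sB [cB hB].
have finj : {in B &, injective (fun i => F (g i))}.
  move=> i j iB jB e; apply/eqP/negPn/negP => /(hB _ _ iB jB).
  by rewrite /meet e setIid E_neq0.
have := matching_le (M := [set F (g i) | i in B]).
rewrite card_in_imset // cB ltnn => /(_ _ _)/negP; apply=> //.
  by apply/subsetP=> _ /imsetP[i _ ->].
apply/trivIsetP => _ _ /imsetP[i iB ->] /imsetP[j jB ->] ne.
rewrite -setI_eq0; have := hB _ _ iB jB; rewrite /meet negbK; apply.
by apply: contraNneq ne => ->.
Qed.

Theorem small_hitting_set :
  exists2 S : {set T}, #|S| <= 11 * lambda ^ 2 * (lambda + nu + 3) * N ^ 2 &
    forall e, e \in E -> S :&: e != set0.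
Proof.
(* [k] is the successor of the sparsity factor [4 * N ^ 2], the form that [low_degree_multiset] asks
   for. The constant [11] suffices because [k <= 5 * N ^ 2]. *)
pose k := (4 * N ^ 2).+1; pose m := 2 * lambda ^ 2 * (lambda + nu + 3).
have N0 : 0 < N by rewrite bin_gt0 leq_addl.
have km : k * m <= 11 * lambda ^ 2 * (lambda + nu + 3) * N ^ 2.
  have : 0 < N ^ 2 by rewrite expn_gt0 N0.
  rewrite /k /m -!mulnA; move: (lambda ^ 2 * (lambda + nu + 3)) (N ^ 2) => x y; nia.
have m0 : 0 < m by rewrite /m !muln_gt0; lia.
have vc S : shatters E S -> #|S| <= 'C(lambda.+1, 2).-1.
  move=> sh; rewrite leqNgt; apply/negP => lt; apply: no_private_pairs.
  by apply: shatters_private_pairs sh; [lia | apply: leq_trans lt; exact: leqSpred].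
have [/existsP[S /andP[cS /forall_inP hS]]|] :=
    boolP [exists S : {set T}, (#|S| <= k * m) && [forall e in E, S :&: e != set0]].
  by exists S => //; apply: leq_trans cS km.
rewrite negb_exists => /forallP no; exfalso.
(* A weighting that makes every edge heavy would yield a net of size [k * m], a hitting set assumed
   absent. *)
have light (w : T -> nat) :
    exists2 e, e \in E & k * \sum_(v in e) w v <= \sum_v w v.
  apply/exists_inP; rewrite -[X in is_true X]negbK negb_exists_in; apply/negP => /forall_inP heavy.
  have size_bound : (2 * (k * m)).+1 ^ 'C(lambda.+1, 2).-1.+1 <= 2 ^ m.
    by rewrite prednK ?bin_gt0 ?net_size_bound //; lia.
  have dense e : e \in E -> \sum_v w v < k * \sum_(v in e) w v.
    by move=> /heavy; rewrite -ltnNge.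
  have [S cS hS] := weighted_epsilon_net m0 dense vc size_bound.
  by have := no S; rewrite cS => /forall_inP; apply.
have [|n [F n0 [FE deg]]] := @low_degree_multiset T E (4 * N ^ 2) _ light.
  by rewrite muln_gt0 expn_gt0 N0.
exact: no_low_degree_multiset n0 FE deg.
Qed.

End DingSeymourWinkler.

(** * Induced paths *)

Lemma free_of_no_embedding (H G : sgraph) (f : H -> G) :
  injective f -> {mono f : x y / adj x y} -> ~ free_of H G.
Proof.
move=> finj fmono /(_ [set x in codom f]); apply.
have inA (u : induced [set x in codom f]) : val u \in codom f.
  by have := valP u; rewrite inE.
have inA' x : f x \in [set x in codom f] by rewrite inE codom_f.
exists (fun u => iinv (inA u)) => [|u v].
  exists (fun x => exist _ (f x) (inA' x) : induced _).
    by move=> u; apply: val_inj; rewrite /= f_iinv.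
  by move=> x; apply: finj; rewrite f_iinv.
by rewrite -fmono !f_iinv.
Qed.

Section Geodesics.
Variable G : sgraph.

(** Walks inside [U] are kept on the type [G], so that different [U] can be compared without moving
    between subtypes. *)
Definition adj_in (U : {set G}) : rel G := fun u v => [&& adj u v, u \in U & v \in U].

Lemma connect_adj_inS (U V : {set G}) u v : U \subset V ->
  connect (adj_in U) u v -> connect (adj_in V) u v.
Proof.
move=> sUV; apply: connect_sub => {}u {}v /and3P[uv uU vU].
by apply: connect1; rewrite /adj_in uv !(subsetP sUV).
Qed.

Section Shortcut.
Variable e : rel G.

Lemma last_take_nth (x : G) (p : seq G) i :
  i <= size p -> last x (take i p) = nth x (x :: p) i.
Proof.
move=> le; rewrite (last_nth x) size_takel //.
by rewrite -[x :: take i p]/(take i.+1 (x :: p)) nth_take.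
Qed.

(** The walk is [x :: p], so [take i p] ends at its vertex [i] and [drop j.-1 p] starts at its
    vertex [j]; the chord joins the two. *)
Lemma path_shortcut x p i j :
  path e x p -> i.+1 < j <= size p -> e (nth x (x :: p) i) (nth x (x :: p) j) ->
  exists q, [/\ path e x q, last x q = last x p & size q < size p].
Proof.
move=> pp /andP[ij jp] eij; exists (take i p ++ drop j.-1 p); split.
- rewrite cat_path take_path // last_take_nth; last by lia.
  rewrite (drop_nth x) /=; last by lia.
  rewrite -[nth x p j.-1]/(nth x (x :: p) j.-1.+1) prednK; last by lia.
  rewrite eij /=; move: pp; rewrite -{1}(cat_take_drop j p) cat_path.
  by rewrite last_take_nth // => /andP[].
- rewrite last_cat -[in RHS](cat_take_drop j.-1 p) last_cat.
  by rewrite (drop_nth x) //; lia.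
by rewrite size_cat size_takel ?size_drop; lia.
Qed.

Lemma connect_shortest x y : connect e x y ->
  exists p, [/\ path e x p, last x p = y &
    forall q, path e x q -> last x q = y -> size p <= size q].
Proof.
case/connectP=> p0 pp0 lp0.
pose P n := [exists p : n.-tuple G, path e x p && (last x p == y)].
have ex : exists n, P n.
  by exists (size p0); apply/existsP; exists (in_tuple p0); rewrite /= pp0 -lp0 eqxx.
have [n /existsP[p /andP[pp /eqP lp]] min] := ex_minnP ex.
exists p; split=> // q pq lq; rewrite size_tuple; apply: min.
by apply/existsP; exists (in_tuple q); rewrite /= pq lq eqxx.
Qed.

End Shortcut.

(* A shortest path is induced, and it is long because [phi] changes slowly. *)
Lemma induced_path_of_potential (U : {set G}) (phi : G -> nat) x y t :
    connect (adj_in U) x y ->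
    {in U &, forall u v, adj u v -> phi v <= (phi u).+1} ->
    phi x + t < phi y ->
  exists2 f : 'I_t.+2 -> G, (forall i, f i \in U) &
    {mono f : i j / @adj (path_graph t.+2) i j >-> adj i j}.
Proof.
case/connect_shortest=> p [pp lp min] lip far.
pose v i := nth x (x :: p) i.
have step i : i < size p -> adj_in U (v i) (v i.+1) by move=> lt; apply: (pathP x pp).
have phi_le i : i <= size p -> phi (v i) <= phi x + i.
  elim: i => [|i IH] lt; first by rewrite addn0.
  have /and3P[uv uU vU] := step i lt.
  by have := lip _ _ uU vU uv; have := IH (ltnW lt); lia.
have szp : t < size p.
  by have := phi_le _ (leqnn _); rewrite /v -last_nth lp; lia.
have vU i : i <= size p -> v i \in U.
  case: i => [|i] lt; last by have /and3P[] := step i lt.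
  by have /and3P[] := step 0 (leq_ltn_trans (leq0n _) szp).
have short i j : i.+1 < j <= size p -> ~~ adj (v i) (v j).
  move=> ij; apply/negP => a; case: (@path_shortcut (adj_in U) x p i j) => //.
    by rewrite /adj_in a !vU //; lia.
  by move=> q [pq]; rewrite lp => /(min q pq); rewrite leqNgt => /negP.
have adjE i j : i < j <= size p -> adj (v i) (v j) = (i.+1 == j).
  move=> ij; have [<-|ne] := eqVneq i.+1 j.
    by have /and3P[-> _ _] := step i ltac:(lia).
  by apply/negbTE/short; lia.
have lt_size (i : 'I_t.+2) : i <= size p by have := ltn_ord i; lia.
exists (fun i => v i) => [i|i j]; first exact: vU.
rewrite /= /path_adj; have := lt_size i; have := lt_size j.
move: (nat_of_ord i) (nat_of_ord j) => a b lb la.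
have [lt|lt|->] := ltngtP a b; last by rewrite adj_irrefl; lia.
  by rewrite adjE ?lt //; lia.
by rewrite adj_sym adjE ?lt //; lia.
Qed.

End Geodesics.

(** For [t > 3] no two vertices of the path have the same neighborhood. The ends of a three-vertex
    path do, so [linked_P3] proves injectivity separately. *)
Lemma path_mono_inj (G : sgraph) t (f : 'I_t -> G) :
  3 < t -> {mono f : i j / @adj (path_graph t) i j >-> adj i j} -> injective f.
Proof.
move=> t3 fmono.
suff twin i j : f i = f j -> ~~ (i < j).
  move=> i j e; apply: val_inj; apply/eqP; rewrite eqn_leq.
  by rewrite leqNgt (twin _ _ (esym e)) leqNgt twin.
move=> e; apply/negP => lt.
have wit n : n < t ->
    (i.+1 == n) || (n.+1 == i) = (j.+1 == n) || (n.+1 == j).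
  move=> ltn; rewrite -[LHS]/(@adj (path_graph t) i (Ordinal ltn)).
  by rewrite -[RHS]/(@adj (path_graph t) j (Ordinal ltn)) -!fmono e.
have lj := ltn_ord j; move: (nat_of_ord i) (nat_of_ord j) lt lj wit => a b lt lj wit.
(* The distinguishing vertex is [b.+1]; if [b] is the last vertex, it is [1] for [a = 0] and [a.-1]
   otherwise. *)
have [lb|lb] := ltnP b.+1 t; first by have := wit _ lb; lia.
have [a0|a0] := posnP a; first by have := wit 1 ltac:(lia); lia.
by have := wit a.-1 ltac:(lia); lia.
Qed.

(** * Sets linked through private attachments *)

Section LinkedSets.
Variables (G : sgraph) (X : {set G}) (n : nat).
Variables (Z : nat -> {set G}) (x : nat -> nat -> G).
Hypothesis X_stable : stable X.
Hypothesis Z_neq0 : forall i, i < n -> Z i != set0.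
Hypothesis Z_connected : forall i, i < n ->
  {in Z i &, forall u v, connect (adj_in (Z i)) u v}.
Hypothesis Z_X : forall i, i < n -> [disjoint X & Z i].
Hypothesis Z_separated : forall i j, i < n -> j < n -> i != j ->
  forall u v, u \in Z i -> v \in Z j -> u != v /\ ~~ adj u v.
Hypothesis x_X : forall i j, i < n -> j < n -> i != j -> x i j \in X.
Hypothesis x_link : forall i j l, i < n -> j < n -> i != j -> l < n ->
  [exists u in Z l, adj (x i j) u] = (l == i) || (l == j).

Lemma x_notin_Z i j l : i < n -> j < n -> i != j -> l < n -> x i j \notin Z l.
Proof.
move=> li lj ne ll; have /disjoint_setI0/setP/(_ (x i j)) := Z_X ll.
by rewrite !inE x_X //= => ->.
Qed.

Lemma x_nonadj_Z i j l u : i < n -> j < n -> i != j -> l < n -> u \in Z l ->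
  l != i -> l != j -> ~~ adj (x i j) u.
Proof.
move=> li lj ne ll uZ nli nlj; apply/negP => a.
have : [exists u in Z l, adj (x i j) u] by apply/exists_inP; exists u.
by rewrite x_link // (negPf nli) (negPf nlj).
Qed.

Lemma x_inj i j i' j' : i < n -> j < n -> i != j -> i' < n -> j' < n -> i' != j' ->
  x i j = x i' j' -> (i == i') || (i == j').
Proof.
by move=> li lj ne li' lj' ne' e; rewrite -x_link // -e x_link ?eqxx.
Qed.

(** The pieces of the forbidden subgraph are built on disjoint blocks [S] of indices. A link belongs
    to a block only when both of its indices do, which keeps different blocks anticomplete. *)
Definition supported (S : pred nat) (v : G) : Prop :=
  (exists i, [/\ S i, i < n & v \in Z i]) \/
  (exists i j, [/\ S i && S j, i < n, j < n, i != j & v = x i j]).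

Lemma supported_separated (S S' : pred nat) u v :
  (forall i, S i -> ~~ S' i) -> supported S u -> supported S' v ->
  u != v /\ ~~ adj u v.
Proof.
move=> SS' su sv.
have ne_of i i' : S i -> S' i' -> i' != i.
  by move=> Si Si'; apply/negP => /eqP e; move: (SS' _ Si); rewrite -e Si'.
case: su sv => [[i [Si li ui]]|[i [j [/andP[Si Sj] li lj ne ->]]]].
  case=> [[i' [Si' li' vi']]|[i' [j' [/andP[Si' Sj'] li' lj' ne' ->]]]].
    by apply: Z_separated ui vi'; rewrite // eq_sym ne_of.
  have nx := x_notin_Z li' lj' ne' li; split; first by apply: contraNneq nx => <-.
  by rewrite adj_sym (x_nonadj_Z li' lj' ne' li ui) // eq_sym ne_of.
case=> [[i' [Si' li' vi']]|[i' [j' [/andP[Si' Sj'] li' lj' ne' ->]]]].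
  have nx := x_notin_Z li lj ne li'; split; first by apply: contraNneq nx => ->.
  by rewrite (x_nonadj_Z li lj ne li' vi') // ne_of.
split; last by apply: X_stable; apply: x_X.
apply/negP => /eqP/(x_inj li lj ne li' lj' ne').
by rewrite ![i == _]eq_sym (negPf (ne_of _ _ Si Si')) (negPf (ne_of _ _ Si Sj')).
Qed.

(* The chain [Z 0], [x 0 1], [Z 1], [x 1 2], ...: only consecutive members touch. *)
Definition chain_at a (v : G) : bool :=
  if odd a then v == x a./2 a./2.+1 else v \in Z a./2.

Lemma chain_far a b u v : a./2.+1 < n -> b./2.+1 < n -> a.+1 < b ->
  chain_at a u -> chain_at b v -> u != v /\ ~~ adj u v.
Proof.
move=> an bn; have := odd_double_half a; have := odd_double_half b.
rewrite /chain_at; move: (odd a) (odd b) a./2 b./2 an bn => [] [] i j lj li eb ea lt.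
- move=> /eqP-> /eqP->; split; last by apply: X_stable; apply: x_X; lia.
  by apply/negP => /eqP/x_inj; lia.
- move=> /eqP-> vZ; split; last by apply: (x_nonadj_Z _ _ _ _ vZ); lia.
  by apply: contraTneq vZ => <-; apply: x_notin_Z; lia.
- move=> uZ /eqP->; split; last by rewrite adj_sym; apply: (x_nonadj_Z _ _ _ _ uZ); lia.
  by apply: contraTneq uZ => ->; apply: x_notin_Z; lia.
by move=> uZ vZ; apply: Z_separated uZ vZ; lia.
Qed.

(** This makes positions along the chain well defined: nonconsecutive members are disjoint by
    [chain_far], and of two consecutive ones one is a point of [X] and the other some [Z i]. *)
Lemma chain_uniq a b v : a./2.+1 < n -> b./2.+1 < n ->
  chain_at a v -> chain_at b v -> a = b.
Proof.
suff ub a' b' : a'./2.+1 < n -> b'./2.+1 < n -> chain_at a' v -> chain_at b' v -> ~~ (a' < b').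
  move=> an bn ca cb; apply/eqP; rewrite eqn_leq leqNgt [b <= a]leqNgt.
  by rewrite (ub b a) // (ub a b).
move=> an bn ca cb; apply/negP => lt.
have [e|ne] := eqVneq b' a'.+1; last first.
  by have [|/eqP] := chain_far an bn _ ca cb; first by lia.
move: ca cb bn; rewrite /chain_at e /= uphalf_half; case o: (odd a') => /=.
  by move=> /eqP-> + bn; apply/negP; apply: x_notin_Z; lia.
by move=> /[swap] /eqP-> + bn; apply/negP; apply: x_notin_Z; lia.
Qed.

(** The position along the chain is a potential that an edge raises by at most one. From [Z 0] to
    [x m m.+1] it rises by [2 * m + 1], so a shortest walk contains an induced path on [2 * m + 2]
    vertices. Index [m.+1] enters only through the last link. *)
Lemma chain_path m : m.+1 < n ->
  exists2 f : 'I_(2 * m).+2 -> G, forall i, supported (fun j => j <= m.+1) (f i) &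
    {mono f : i j / @adj (path_graph (2 * m).+2) i j >-> adj i j}.
Proof.
move=> mn; pose U := [set v | [exists a : 'I_(2 * m).+2, chain_at a v]].
pose phi v := if [pick a : 'I_(2 * m).+2 | chain_at a v] is Some a then nat_of_ord a else 0.
have inU a v : a < (2 * m).+2 -> chain_at a v -> v \in U.
  by move=> lt ca; rewrite inE; apply/existsP; exists (Ordinal lt).
have phiE a v : a < (2 * m).+2 -> chain_at a v -> phi v = a.
  move=> lt ca; rewrite /phi; case: pickP => [b cb|/(_ (Ordinal lt))]; last by rewrite ca.
  by apply: chain_uniq cb ca; have := ltn_ord b; lia.
have lip : {in U &, forall u v, adj u v -> phi v <= (phi u).+1}.
  move=> u v; rewrite !inE => /existsP[a ca] /existsP[b cb] uv.
  rewrite (phiE a u) // (phiE b v) // leqNgt; apply/negP => lt.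
  have an : a./2.+1 < n by have := ltn_ord a; lia.
  have bn : b./2.+1 < n by have := ltn_ord b; lia.
  by have [_] := chain_far an bn lt ca cb; rewrite uv.
have ZU i : i <= m -> Z i \subset U.
  move=> le; apply/subsetP => v vZ; apply: (inU (i.*2)); first by lia.
  by rewrite /chain_at odd_double doubleK.
have xU i : i <= m -> x i i.+1 \in U.
  move=> le; apply: (inU (i.*2.+1)); first by lia.
  by rewrite /chain_at /= odd_double uphalf_double eqxx.
have to_x i z : i <= m -> z \in Z i -> connect (adj_in U) z (x i i.+1).
  move=> le zi; have : [exists u in Z i, adj (x i i.+1) u] by rewrite x_link; lia.
  case/exists_inP=> u ui xu; apply: (@connect_trans _ _ u).
    by apply: connect_adj_inS (ZU i le) _; apply: Z_connected; rewrite //; lia.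
  by apply: connect1; rewrite /adj_in adj_sym xu xU // (subsetP (ZU i le)).
have reach i z : z \in Z 0 -> i <= m -> connect (adj_in U) z (x i i.+1).
  move=> z0; elim: i => [|i IH] le; first exact: to_x.
  have : [exists u in Z i.+1, adj (x i i.+1) u] by rewrite x_link; lia.
  case/exists_inP=> u ui xu; apply: connect_trans (IH (ltnW le)) _.
  apply: (@connect_trans _ _ u); last exact: to_x.
  by apply: connect1; rewrite /adj_in xu xU ?(ltnW le) // (subsetP (ZU _ le)).
have /set0Pn[z z0] : Z 0 != set0 by apply: Z_neq0; lia.
have phiz : phi z = 0 by apply: phiE.
have phix : phi (x m m.+1) = (2 * m).+1.
  by apply: phiE => //; rewrite mul2n /chain_at /= odd_double uphalf_double eqxx.
have [|f fU fmono] := induced_path_of_potential (reach m z z0 (leqnn m)) lip (t := 2 * m).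
  by rewrite phiz phix.
exists f => // i; have := fU i; rewrite inE => /existsP[a]; have := ltn_ord a.
have := odd_double_half a; rewrite /chain_at.
move: (odd a) (a./2) => [] j ea la.
  by move/eqP=> ->; right; exists j, j.+1; split=> //=; lia.
by move=> fZ; left; exists j; split=> //=; lia.
Qed.

Lemma linked_P3 i j : i < n -> j < n -> i != j ->
  exists2 f : 'I_3 -> G, forall t, supported (pred2 i j) (f t) &
    injective f /\ {mono f : s t / @adj (path_graph 3) s t >-> adj s t}.
Proof.
move=> li lj ne.
have /exists_inP[u ui xu] : [exists u in Z i, adj (x i j) u] by rewrite x_link ?eqxx.
have /exists_inP[v vj xv] : [exists u in Z j, adj (x i j) u] by rewrite x_link ?eqxx ?orbT.
have [uv nuv] := Z_separated li lj ne ui vj.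
have xui : x i j != u by apply: contraTneq ui => <-; apply: x_notin_Z.
have xvj : x i j != v by apply: contraTneq vj => <-; apply: x_notin_Z.
exists (fun t : 'I_3 => nth u [:: u; x i j; v] t).
  case=> [[|[|[|t]]] //= lt].
  - by left; exists i; rewrite /= eqxx.
  - by right; exists i, j; rewrite /= !eqxx orbT.
  - by left; exists j; rewrite /= eqxx orbT.
split.
  move=> s t /eqP; rewrite nth_uniq //= => [/eqP/val_inj //|].
  by rewrite !inE negb_or uv eq_sym xui xvj.
case=> [[|[|[|s]]] //= ls] [[|[|[|t]]] //= lt]; rewrite /path_adj /= ?adj_irrefl //.
- by rewrite adj_sym xu.
- exact: negPf.
- by rewrite adj_sym (negPf nuv).
- by rewrite adj_sym xv.
Qed.

(** Indices [0] to [3] carry the six-vertex path, the chain with [m = 2]; indices [4 + 2 * a] and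
    [5 + 2 * a] carry the three-vertex path number [a]. *)
Lemma linked_sets_not_free r : 2 * r + 4 <= n ->
  ~ free_of (disjoint_union (path_graph 6) (copies r (path_graph 3))) G.
Proof.
move=> le; have [f fs fmono] := @chain_path 2 ltac:(lia).
have P3 (a : 'I_r) : exists h : 'I_3 -> G,
    [/\ forall t, supported (pred2 (4 + 2 * a) (5 + 2 * a)) (h t), injective h &
    {mono h : s t / @adj (path_graph 3) s t >-> adj s t}].
  have [|||h hs [hinj hmono]] := @linked_P3 (4 + 2 * a) (5 + 2 * a);
    try by have := ltn_ord a; lia.
  by exists h.
have [g gP] := fin_all_exists P3.
have sep6 i a t : f i != g a t /\ ~~ adj (f i) (g a t).
  have [gs _ _] := gP a; apply: supported_separated (fs i) (gs t).
  by move=> j /=; lia.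
have sep3 a b s t : a != b -> g a s != g b t /\ ~~ adj (g a s) (g b t).
  move=> ne; have [gs _ _] := gP a; have [gs' _ _] := gP b.
  apply: supported_separated (gs s) (gs' t) => j /=.
  by move: ne; rewrite -val_eqE /=; lia.
pose F (w : disjoint_union (path_graph 6) (copies r (path_graph 3))) :=
  match w with inl i => f i | inr u => g u.1 u.2 end.
apply: (@free_of_no_embedding _ _ F).
  have finj : injective f by apply: path_mono_inj fmono.
  case=> [i|[a s]] [j|[b t]] //=.
  - by move/finj->.
  - by move=> e; have [/eqP] := sep6 i b t.
  - by move=> e; have [/eqP] := sep6 j a s; rewrite e.
  have [<-|ne e] := eqVneq a b; last by have [/eqP] := sep3 a b s t ne.
  by have [_ ginj _] := gP a => /ginj->.
case=> [i|[a s]] [j|[b t]] //=.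
- by have [_ /negPf] := sep6 i b t.
- by rewrite adj_sym; have [_ /negPf] := sep6 j a s.
rewrite /copies_adj /=; have [<-|ne] := eqVneq a b; last by have [_ /negPf] := sep3 a b s t ne.
by have [_ _ gmono] := gP a; rewrite gmono.
Qed.

End LinkedSets.

(** * The attachment hypergraph *)

Lemma tau_leq_hitting (T : finType) (H : hypergraph T) (S : {set T}) :
  (forall e, e \in hyperedges H -> S :&: e != set0) -> tau H <= #|S|.
Proof.
move=> hS; rewrite /tau; case: arg_minnP => [|S0 _ min]; first exact: hitting_set_hvertices.
apply: leq_trans (min (S :&: hvertices H) _) (subset_leq_card (subsetIl _ _)).
rewrite /hitting_set subsetIr; apply/forall_inP => e eH.
by rewrite -setIA (setIidPr (hyperedge_sub eH)) hS.
Qed.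

Lemma card_matching_leq_nu (T : finType) (H : hypergraph T) (M : {set {set T}}) :
  M \subset hyperedges H -> trivIset M -> #|M| <= nu H.
Proof.
move=> sM tM.
have mM : matching H M by rewrite /matching sM.
exact: (@leq_bigmax_cond _ (matching H) (fun N : {set {set T}} => #|N|)).
Qed.

Section Components.
Variable G : sgraph.
Implicit Types (U : {set G}).

Lemma adj_in_sym U : symmetric (adj_in U).
Proof. by move=> u v; rewrite /adj_in adj_sym [(u \in U) && _]andbC. Qed.

Lemma connect_adj_in_sym U : connect_sym (adj_in U).
Proof. exact: sym_connect_sym (@adj_in_sym U). Qed.

Lemma connect_adj_inP U u v (uU : u \in U) : connect (adj_in U) u v ->
  exists vU : v \in U,
    connect (@adj (induced U)) (exist _ u uU) (exist _ v vU).
Proof.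
case/connectP=> p; elim: p u uU => [|w p IH] u uU /= => [_ ->|]; first by exists uU.
case/andP=> /and3P[uw _ wU] /IH/[apply] /(_ wU)[vU c]; exists vU.
by apply: connect_trans c; apply: connect1.
Qed.

Lemma connected_adj_in U : connected_graph (induced U) ->
  {in U &, forall u v, connect (adj_in U) u v}.
Proof.
move=> conn u v uU vU; have /connectP[p] := conn (exist _ u uU) (exist _ v vU).
elim: p u uU => [|[w wU] p IH] u uU /= => [_ [->]|/andP[uw pw] lw]; first exact: connect0.
apply: (@connect_trans _ _ w); last exact: IH wU pw lw.
by apply: connect1; apply/and3P.
Qed.

Lemma card_component U p u : u \in U ->
    (forall K, K \in components (induced U) -> #|K| <= p) ->
  #|[set v | connect (adj_in U) u v]| <= p.
Proof.
move=> uU small; pose K := [set y | connect (@adj (induced U)) (exist _ u uU) y].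
apply: (@leq_trans #|val @: K|); last first.
  by apply: leq_trans (leq_imset_card _ _) _; apply: small; apply: imset_f.
apply: subset_leq_card; apply/subsetP => v; rewrite inE.
case/(connect_adj_inP uU)=> vU c; apply/imsetP; exists (exist _ v vU) => //.
by rewrite inE.
Qed.

End Components.

(** A component of [G|Y] has at most ['C(p, q)] subsets of size [q], so more than
    ['C(p, q) * (2 * r + 3)] distinct sets [Z i] occupy at least [2 * r + 4] components. One set
    from each, linked by the private points, contradicts [linked_sets_not_free]. *)
Lemma attachment_no_private_pairs (r p q : nat) (G : sgraph) (X Y : {set G})
    (ZZ : {set {set G}}) k :
    free_of (disjoint_union (path_graph 6) (copies r (path_graph 3))) G ->
    0 < q -> [disjoint X & Y] -> stable X ->
    (forall K, K \in components (induced Y) -> #|K| <= p) ->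
    (forall Z, Z \in ZZ -> Z \subset Y) -> (forall Z, Z \in ZZ -> #|Z| = q) ->
    (forall Z, Z \in ZZ -> connected_graph (induced Z)) ->
    2 < k -> 'C(p, q) * (2 * r + 3) < k ->
  ~ private_pairs [set attachments X Z | Z in ZZ] k.
Proof.
move=> hG q0 XY Xst hY hsub hcard hconn k2 big [F FE Fx].
have /fin_all_exists[Z Zprop] (i : 'I_k) : exists Z, Z \in ZZ /\ F i = attachments X Z.
  by have /imsetP[Z ZZZ ->] := FE i; exists Z.
have ZZi i : Z i \in ZZ by case: (Zprop i).
have FZ i : F i = attachments X (Z i) by case: (Zprop i).
have /fin_all_exists[z zZ] (i : 'I_k) : exists z, z \in Z i.
  by apply/card_gt0P; rewrite hcard.
have /fin_all_exists[x xP] (i : 'I_k) : exists xi : 'I_k -> G,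
    forall j, i != j -> forall l, (xi j \in F l) = (l == i) || (l == j).
  apply: (@fin_all_exists _ _ (fun j y => i != j -> forall l, (y \in F l) = (l == i) || (l == j))).
  (* The choice function is total, so the diagonal gets the arbitrary value [z i]. *)
  move=> j; have [e|ne] := eqVneq i j; first by exists (z i).
  by have [y yP] := Fx i j ne; exists y.
have sZY i : Z i \subset Y by apply: hsub.
(* With a third index [l], the private point of [i] and [l] lies in [F i] but not in [F j]. *)
have Zinj : injective Z.
  move=> i j e; apply/eqP/negPn/negP => ne.
  have [l /andP[li lj]] : exists l, (l != i) && (l != j).
    apply/existsP; rewrite -[X in is_true X]negbK negb_exists; apply/negP => /forallP h.
    have : #|[set: 'I_k]| <= #|[set i; j]|.
      apply: subset_leq_card; apply/subsetP => l _; have := h l.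
      by rewrite !inE negb_and !negbK.
    by rewrite cardsT card_ord cards2; lia.
  have := xP i l; rewrite eq_sym => /(_ li j).
  rewrite FZ -e -FZ xP ?eqxx; last by rewrite eq_sym.
  by rewrite ![j == _]eq_sym (negPf ne) (negPf lj).
pose D i := [set v | connect (adj_in Y) (z i) v].
have Zconn i : {in Z i &, forall u v, connect (adj_in (Z i)) u v}.
  by apply: connected_adj_in; apply: hconn.
have ZconnY i : {in Z i &, forall u v, connect (adj_in Y) u v}.
  by move=> u v ui vi; apply: connect_adj_inS (sZY i) _; apply: Zconn.
have ZD i : Z i \subset D i.
  by apply/subsetP => v vi; rewrite inE; apply: ZconnY vi.
have Dsep i j u v : D i != D j -> u \in Z i -> v \in Z j -> u != v /\ ~~ adj u v.
  move=> ne ui vj; suff nc : ~~ connect (adj_in Y) u v.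
    split; first by apply: contraNneq nc => ->; apply: connect0.
    apply: contra nc => uv; apply: connect1.
    by rewrite /adj_in uv (subsetP (sZY i)) ?(subsetP (sZY j)).
  apply: contraNN ne => c; apply/eqP/setP => w; rewrite !inE.
  apply: (same_connect (connect_adj_in_sym Y)).
  apply: connect_trans (ZconnY i _ _ (zZ i) ui) _.
  by apply: connect_trans c _; apply: ZconnY vj (zZ j).
pose R := [set D i | i : 'I_k].
have cR : 2 * r + 4 <= #|R|.
  suff : k <= #|R| * 'C(p, q) by move: big; nia.
  rewrite -sum_nat_const -[X in X <= _]card_ord -sum1_card.
  rewrite (partition_big D (mem R)) /=; last by move=> i _; apply: imset_f.
  apply: leq_sum => K /imsetP[i0 _ KE]; rewrite sum1dep_card.
  apply: (@leq_trans #|[set A : {set G} | (A \subset K) && (#|A| == q)]|).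
    rewrite -(card_imset _ Zinj); apply: subset_leq_card.
    apply/subsetP => _ /imsetP[i + ->]; rewrite !inE => /eqP <-.
    by rewrite ZD hcard ?eqxx.
  rewrite cards_draws leq_bin2l // KE; apply: card_component hY.
  exact: (subsetP (sZY i0)).
have i0 : 'I_k by exists 0; lia.
(* [idx a] picks a set inside the component number [a] of [R]; the default [i0] is not reached for
   [a < 2 * r + 4]. *)
pose idx a := odflt i0 [pick i | D i == nth set0 (enum R) a].
have Didx a : a < 2 * r + 4 -> D (idx a) = nth set0 (enum R) a.
  move=> lt; rewrite /idx; case: pickP => [i /eqP //|no].
  have : nth set0 (enum R) a \in R by rewrite -mem_enum mem_nth // -cardE; lia.
  by case/imsetP=> i _ /esym/eqP; rewrite no.
have Dne a b : a < 2 * r + 4 -> b < 2 * r + 4 -> a != b -> D (idx a) != D (idx b).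
  by move=> la lb; rewrite !Didx // nth_uniq ?enum_uniq -?cardE //; lia.
have idx_inj a b : a < 2 * r + 4 -> b < 2 * r + 4 -> (idx a == idx b) = (a == b).
  move=> la lb; apply/eqP/eqP => [e|-> //]; apply/eqP/negPn/negP => /(Dne _ _ la lb).
  by rewrite e eqxx.
have xX i j : i != j -> x i j \in X.
  by move=> ne; have := xP i j ne i; rewrite eqxx FZ !inE => /andP[].
apply: (@linked_sets_not_free G X (2 * r + 4) (fun a => Z (idx a))
          (fun a b => x (idx a) (idx b)) Xst _ _ _ _ _ _ r (leqnn _) hG).
- by move=> a _; apply/set0Pn; exists (z (idx a)).
- by move=> a _; apply: Zconn.
- by move=> a _; apply: disjointWr XY.
- by move=> a b la lb ne u v; apply: Dsep; apply: Dne.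
- by move=> a b la lb ne; apply: xX; rewrite idx_inj.
move=> a b l la lb ne ll; rewrite -(idx_inj l a) // -(idx_inj l b) //.
have neI : idx a != idx b by rewrite idx_inj.
(* Points of [X] lie outside [Y], hence outside [Z (idx l)], so being an attachment amounts to
   having a neighbor there. *)
rewrite -(xP _ _ neI) FZ !inE xX //= /attachment.
suff -> : x (idx a) (idx b) \notin Z (idx l) by [].
apply/negP => /(subsetP (sZY _)); apply/negP.
by have /disjoint_setI0/setP/(_ (x (idx a) (idx b))) := XY; rewrite !inE xX //= => ->.
Qed.

Theorem theorem2p6 (r p q : nat) (hp : 0 < p) (hq : 0 < q) :
  (forall (G : sgraph)
     (hG : free_of (disjoint_union (path_graph 6) (copies r (path_graph 3))) G)
     (X Y : {set G}) (hXY : [disjoint X & Y]) (hX : stable X)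
     (hY : forall K, K \in components (induced Y) -> #|K| <= p)
     (ZZ : {set {set G}})
     (hsub : forall Z, Z \in ZZ -> Z \subset Y)
     (hcard : forall Z, Z \in ZZ -> #|Z| = q)
     (hconn : forall Z, Z \in ZZ -> connected_graph (induced Z))
     (hatt : forall Z, Z \in ZZ -> attachments X Z != set0),
     let H := attachment_hypergraph hatt in
     let C := 'C(p, q) * (2 * r + 4) in
     tau H <= 11 * C ^ 2 * (C + nu H + 3) * 'C(C + nu H, nu H) ^ 2)
  /\
  (exists f : nat -> nat, forall (G : sgraph)
     (hG : free_of (disjoint_union (path_graph 6) (copies r (path_graph 3))) G)
     (X Y : {set G}) (hXY : [disjoint X & Y]) (hX : stable X)
     (hY : forall K, K \in components (induced Y) -> #|K| <= p)
     (ZZ : {set {set G}})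
     (hsub : forall Z, Z \in ZZ -> Z \subset Y)
     (hcard : forall Z, Z \in ZZ -> #|Z| = q)
     (hconn : forall Z, Z \in ZZ -> connected_graph (induced Z))
     (hatt : forall Z, Z \in ZZ -> attachments X Z != set0),
     let H := attachment_hypergraph hatt in
     tau H <= f (nu H)).
Proof.
set bound := (X in X /\ _); suff main : bound.
  split=> //; pose C := 'C(p, q) * (2 * r + 4).
  exists (fun n => 11 * C ^ 2 * (C + n + 3) * 'C(C + n, n) ^ 2).
  by move=> G hG X Y hXY hX hY ZZ hsub hcard hconn hatt; apply: (main G hG X Y).
move=> G hG X Y hXY hX hY ZZ hsub hcard hconn hatt.
set H := attachment_hypergraph hatt; pose C := 'C(p, q) * (2 * r + 4).
change (tau H <= 11 * C ^ 2 * (C + nu H + 3) * 'C(C + nu H, nu H) ^ 2).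
(* Empty [ZZ] is treated apart because ['C(p, q)] may then vanish; a member of [ZZ] forces [q <= p],
   as it lies in one component of [G|Y]. *)
have [e0|[Z ZZZ]] := set_0Vmem ZZ.
  apply: leq_trans (_ : #|@set0 G| <= _); last by rewrite cards0.
  by apply: tau_leq_hitting => e /imsetP[Z]; rewrite e0 inE.
have qp : 0 < 'C(p, q).
  have /card_gt0P[z zZ] : 0 < #|Z| by rewrite hcard.
  have zY : z \in Y by apply: (subsetP (hsub _ ZZZ)).
  rewrite bin_gt0 -(hcard _ ZZZ); apply: leq_trans (card_component zY hY).
  apply: subset_leq_card; apply/subsetP => v vZ; rewrite inE.
  by apply: connect_adj_inS (hsub _ ZZZ) _; apply: connected_adj_in (hconn _ ZZZ) _ _ zZ vZ.
have C2 : 2 < C by rewrite /C; nia.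
have nopp : ~ private_pairs (hyperedges H) C.+1.
  by apply: (attachment_no_private_pairs hG hq hXY hX hY hsub hcard hconn); rewrite /C; nia.
have [|S cS hS] := small_hitting_set C2 _ nopp (@card_matching_leq_nu _ H).
  by move=> e; apply: hyperedge_neq0.
exact: leq_trans (tau_leq_hitting hS) cS.
Qed.
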